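(* Let $f:\mathbb{R}^n\to\mathbb{R}$ be twice continuously differentiable. Suppose that $\nabla^2 f$ is $M$-Lipschitz continuous ($M>0$) on an open convex set $X$ containing all the iterates $x_k$ of HSODM (described in the context, run without early termination and with $\delta=0$ in the local phase), and that $\|\nabla^2 f(x_k)\|\le U_H$ for all $k$, for some $U_H>0$. Suppose further that HSODM converges to a strict local optimum $x^*$ with $\nabla f(x^* )=0$ and $\nabla^2 f(x^* )\succ0$, and let $R>0$, $\mu>0$ be such that $\nabla^2 f(x)\succeq\mu I$ for all $x\in B(x^*,R)$. Then for sufficiently large $k$, HSODM converges to $x^*$ quadratically, that is, $$\|x_{k+1}-x^*\|\le\left(\frac{M}{\mu}+\frac{\Delta(MR+\mu)^2}{\mu^2(1-\Delta^2)^2}\right)\|x_k-x^*\|^2 .$$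
   Context: Notation: $\|\cdot\|$ is the Euclidean norm (induced norm for matrices), $B(x,R)$ the closed ball, $[a;b]$ vertical concatenation, $g_k=\nabla f(x_k)$, $H_k=\nabla^2f(x_k)$. HSODM (Homogeneous Second-Order Descent Method). Parameters: $\delta\ge0$, $\nu\in(0,1/2)$, and $\Delta=\Theta(\sqrt\epsilon)$ for a small tolerance $\epsilon>0$ (so $0<\Delta\le\sqrt2/2$). At iteration $k$, let $$F_k=\begin{bmatrix}H_k & g_k\\ g_k^T & -\delta\end{bmatrix}$$ and compute an optimal solution $[v_k;t_k]$ of $\min_{\|[v;t]\|\le1}[v;t]^TF_k[v;t]$, i.e. a unit eigenvector for the smallest eigenvalue of $F_k$. (i) Small value case: if $|t_k|>\sqrt{1/(1+\Delta^2)}$, set $d_k=v_k/t_k$ and $x_{k+1}=x_k+d_k$; then, instead of terminating, set $\delta=0$ and proceed. (ii) Otherwise, if $|t_k|\ge\nu$, set $d_k=v_k/t_k$; (iii) otherwise set $d_k=\operatorname{sign}(-g_k^Tv_k)\,v_k$, where $\operatorname{sign}(0)$ is taken to be $1$. In cases (ii), (iii) choose a stepsize $\eta_k$ either as $\eta_k=\Delta/\|d_k\|$ (fixed-radius strategy) or by backtracking ($\eta_k=\beta^j$ for the smallest integer $j\ge0$ with $f(x_k)-f(x_k+\beta^jd_k)\ge\frac{\gamma}{6}\beta^{3j}\|d_k\|^3$, where $\beta\in(0,1)$, $\gamma>0$), and set $x_{k+1}=x_k+\eta_kd_k$. In the local phase (all sufficiently large $k$) the perturbation parameter is $\delta=0$.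 *)

(* Defs.v *)
From HB Require Import structures.
From mathcomp Require Export all_boot all_order all_algebra.
From mathcomp Require Export all_classical all_reals all_analysis.

Set Implicit Arguments.
Unset Strict Implicit.
Unset Printing Implicit Defensive.

Export Order.TTheory GRing.Theory Num.Theory.
Export numFieldNormedType.Exports.

Local Open Scope classical_set_scope.
Local Open Scope ring_scope.

(* The library norm on matrices is the sup norm. It induces the topology used
   below for openness, differentiability and convergence; all the metric
   estimates use the Euclidean norm [enorm] and its induced norm [opnorm]. *)
Definition enorm {R : realType} {n : nat} (v : 'cV[R]_n) : R :=
  Num.sqrt (\sum_(i < n) v i 0 ^+ 2).

Definition opnorm {R : realType} {m n : nat} (A : 'M[R]_(m, n)) : R :=
  sup [set enorm (A *m v) | v in [set v : 'cV[R]_n | enorm v <= 1]].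

Definition closed_eball {R : realType} {n : nat} (c : 'cV[R]_n) (r : R) :
    set 'cV[R]_n :=
  [set y | enorm (y - c) <= r].

Definition qform {R : realType} {n : nat} (A : 'M[R]_n) (v : 'cV[R]_n) : R :=
  (v^T *m A *m v) 0 0.

(* These are only applied to symmetric matrices (Hessians of C^2 functions and
   their shifts), so symmetry is not part of the definitions. *)
Definition posdefmx {R : realType} {n : nat} (A : 'M[R]_n) : Prop :=
  forall v : 'cV[R]_n, v != 0 -> 0 < qform A v.

Definition possemidefmx {R : realType} {n : nat} (A : 'M[R]_n) : Prop :=
  forall v : 'cV[R]_n, 0 <= qform A v.

Definition gradient {R : realType} {n : nat} (f : 'cV[R]_n -> R)
    (x : 'cV[R]_n) : 'cV[R]_n :=
  \col_(i < n) 'D_(delta_mx i 0) f x.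

Definition hessian {R : realType} {n : nat} (f : 'cV[R]_n -> R)
    (x : 'cV[R]_n) : 'M[R]_n :=
  \matrix_(i < n, j < n)
    'D_(delta_mx j 0) (fun y : 'cV[R]_n => gradient f y i 0) x.

(* The Frechet derivatives exist everywhere, hence the partial derivatives
   above are true limits and not the default value of [lim]. *)
Definition twice_continuously_differentiable {R : realType} {n : nat}
    (f : 'cV[R]_n -> R) : Prop :=
  [/\ forall x, differentiable f x,
      forall x, differentiable (gradient f) x
    & continuous (hessian f)].

Definition strict_local_minimizer {R : realType} {n : nat}
    (f : 'cV[R]_n -> R) (x : 'cV[R]_n) : Prop :=
  \forall y \near x^', f x < f y.

Definition hessian_lipschitz_on {R : realType} {n : nat} (M : R)
    (X : set 'cV[R]_n) (f : 'cV[R]_n -> R) : Prop :=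
  forall x y, X x -> X y ->
    opnorm (hessian f x - hessian f y) <= M * enorm (x - y).

Definition homogenized_mx {R : realType} {n : nat} (H : 'M[R]_n)
    (g : 'cV[R]_n) (delta : R) : 'M[R]_(n + 1) :=
  block_mx H g g^T (- delta)%:M.

(* An optimal solution of the homogenized trust-region problem, of unit norm.
   The norm condition discards the non-unit optimal solutions (such as 0) that
   exist exactly when the smallest eigenvalue of F is 0. *)
Definition unit_ball_minimizer {R : realType} {n : nat} (F : 'M[R]_n)
    (w : 'cV[R]_n) : Prop :=
  enorm w = 1 /\
  forall u : 'cV[R]_n, enorm u <= 1 -> qform F w <= qform F u.

(* Unlike [Num.sg], this sign maps 0 to 1. *)
Definition sign1 {R : realType} (a : R) : R := if 0 <= a then 1 else -1.

Definition hsodm_small_value {R : realType} (Delta t : R) : bool :=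
  Num.sqrt (1 / (1 + Delta ^+ 2)) < `|t|.

Definition hsodm_direction {R : realType} {n : nat} (nu Delta : R)
    (g v : 'cV[R]_n) (t : R) : 'cV[R]_n :=
  if hsodm_small_value Delta t || (nu <= `|t|) then t^-1 *: v
  else sign1 (- (g^T *m v) 0 0) *: v.

Definition fixed_radius_stepsize {R : realType} {n : nat} (Delta : R)
    (d : 'cV[R]_n) (eta : R) : Prop :=
  eta = Delta / enorm d.

Definition backtracking_stepsize {R : realType} {n : nat}
    (f : 'cV[R]_n -> R) (beta gamma : R) (x d : 'cV[R]_n) (eta : R) : Prop :=
  let sufficient_decrease (j : nat) :=
    gamma / 6 * beta ^+ (3 * j) * enorm d ^+ 3 <= f x - f (x + beta ^+ j *: d)
  in
  exists j : nat,
    [/\ eta = beta ^+ j, sufficient_decrease j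
      & forall i : nat, (i < j)%N -> ~ sufficient_decrease i].

(* One iteration, from the iterate [x] and perturbation parameter [delta] to
   [x'] and [delta']. In the small value case the method does not terminate
   but resets the perturbation to 0. The choice of the stepsize strategy is
   left free at each iteration, which covers both global strategies. *)
Definition hsodm_step {R : realType} {n : nat} (f : 'cV[R]_n -> R)
    (nu Delta beta gamma : R) (x : 'cV[R]_n) (delta : R)
    (x' : 'cV[R]_n) (delta' : R) : Prop :=
  exists (v : 'cV[R]_n) (t : R),
    let d := hsodm_direction nu Delta (gradient f x) v t in
    unit_ball_minimizer
      (homogenized_mx (hessian f x) (gradient f x) delta)
      (col_mx v t%:M) /\
    if hsodm_small_value Delta t then x' = x + d /\ delta' = 0
    else delta' = delta /\
      exists2 eta : R,
        fixed_radius_stepsize Delta d eta \/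
        backtracking_stepsize f beta gamma x d eta
      & x' = x + eta *: d.

Definition hsodm_run {R : realType} {n : nat} (f : 'cV[R]_n -> R)
    (nu Delta beta gamma delta0 : R) (x : nat -> 'cV[R]_n)
    (delta : nat -> R) : Prop :=
  delta 0%N = delta0 /\
  forall k : nat,
    hsodm_step f nu Delta beta gamma (x k) (delta k) (x k.+1) (delta k.+1).

(* Main.v *)
Require Import Defs.
From mathcomp Require Import ring lra.

(* Once delta = 0, the eigenvector equation of the homogenized matrix reads
   (H + theta) d = - g with theta = - <g, d> >= 0; its derivation needs the
   Hessian to be symmetric (Schwarz). Near the limit H >= mu, so that
   |d| <= |g| / mu is smaller than Delta: the small value case always occurs and
   the unit step is taken. For the error e, (H + theta) (e + d) =
   (H e - g) + theta e, where |H e - g| <= M / 2 |e|^2 by Taylor's formula and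
   theta |e| <= |g|^2 |e| / mu = O(|e|^3) is eventually below M / 2 |e|^2. The
   term M / mu of the rate is thus already sufficient. *)

Set Implicit Arguments.
Unset Strict Implicit.
Unset Printing Implicit Defensive.

Local Open Scope classical_set_scope.
Local Open Scope ring_scope.

(** * Euclidean inner product, norm and induced norm; minimizers as eigenvectors *)

Definition edot {R : realType} {n : nat} (u v : 'cV[R]_n) : R :=
  (u^T *m v) 0 0.

Lemma edotE (R : realType) (n : nat) (u v : 'cV[R]_n) :
  edot u v = \sum_i u i 0 * v i 0.
Proof. by rewrite /edot mxE; apply: eq_bigr => i _; rewrite mxE. Qed.

Lemma edotC (R : realType) (n : nat) (u v : 'cV[R]_n) : edot u v = edot v u.
Proof. by rewrite !edotE; apply: eq_bigr => i _; rewrite mulrC. Qed.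

Lemma edot0r (R : realType) (n : nat) (u : 'cV[R]_n) : edot u 0 = 0.
Proof. by rewrite /edot mulmx0 mxE. Qed.

Lemma edot0l (R : realType) (n : nat) (u : 'cV[R]_n) : edot 0 u = 0.
Proof. by rewrite edotC edot0r. Qed.

Lemma edotDr (R : realType) (n : nat) (u v w : 'cV[R]_n) :
  edot u (v + w) = edot u v + edot u w.
Proof. by rewrite /edot mulmxDr mxE. Qed.

Lemma edotZr (R : realType) (n : nat) (u v : 'cV[R]_n) (a : R) :
  edot u (a *: v) = a * edot u v.
Proof. by rewrite /edot -scalemxAr mxE. Qed.

Lemma edotNr (R : realType) (n : nat) (u v : 'cV[R]_n) :
  edot u (- v) = - edot u v.
Proof. by rewrite -scaleN1r edotZr mulN1r. Qed.

Lemma edotDl (R : realType) (n : nat) (u v w : 'cV[R]_n) :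
  edot (v + w) u = edot v u + edot w u.
Proof. by rewrite edotC edotDr !(edotC u). Qed.

Lemma edotZl (R : realType) (n : nat) (u v : 'cV[R]_n) (a : R) :
  edot (a *: v) u = a * edot v u.
Proof. by rewrite edotC edotZr edotC. Qed.

Lemma edotNl (R : realType) (n : nat) (u v : 'cV[R]_n) :
  edot (- v) u = - edot v u.
Proof. by rewrite edotC edotNr edotC. Qed.

Lemma edot_mulmx (R : realType) (n : nat) (A : 'M[R]_n) (u v : 'cV[R]_n) :
  edot u (A *m v) = edot (A^T *m u) v.
Proof. by rewrite /edot trmx_mul trmxK mulmxA. Qed.

Lemma qformE (R : realType) (n : nat) (A : 'M[R]_n) (v : 'cV[R]_n) :
  qform A v = edot v (A *m v).
Proof. by rewrite /qform /edot mulmxA. Qed.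

Lemma edot_ge0 (R : realType) (n : nat) (v : 'cV[R]_n) : 0 <= edot v v.
Proof. by rewrite edotE sumr_ge0// => i _; rewrite -expr2 sqr_ge0. Qed.

Lemma enormE (R : realType) (n : nat) (v : 'cV[R]_n) :
  enorm v = Num.sqrt (edot v v).
Proof. by rewrite edotE. Qed.

Lemma sqr_enorm (R : realType) (n : nat) (v : 'cV[R]_n) :
  enorm v ^+ 2 = edot v v.
Proof. by rewrite enormE sqr_sqrtr// edot_ge0. Qed.

Lemma enorm_ge0 (R : realType) (n : nat) (v : 'cV[R]_n) : 0 <= enorm v.
Proof. exact: sqrtr_ge0. Qed.

Lemma edot_eq0 (R : realType) (n : nat) (v : 'cV[R]_n) :
  edot v v = 0 -> v = 0.
Proof.
rewrite edotE => /eqP; rewrite psumr_eq0; last first.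
  by move=> i _; rewrite -expr2 sqr_ge0.
move=> /allP v0; apply/colP => i; rewrite mxE; apply/eqP.
by have := v0 i (mem_index_enum _); rewrite -expr2 sqrf_eq0.
Qed.

Lemma enorm_eq0 (R : realType) (n : nat) (v : 'cV[R]_n) :
  enorm v = 0 -> v = 0.
Proof. by move=> v0; apply: edot_eq0; rewrite -sqr_enorm v0 expr0n. Qed.

Lemma enorm0 (R : realType) (n : nat) : enorm (0 : 'cV[R]_n) = 0.
Proof. by rewrite enormE edot0l sqrtr0. Qed.

Lemma enormZ (R : realType) (n : nat) (v : 'cV[R]_n) (a : R) :
  enorm (a *: v) = `|a| * enorm v.
Proof.
by rewrite !enormE edotZl edotZr mulrA -expr2 sqrtrM ?sqr_ge0// sqrtr_sqr.
Qed.

Lemma enormN (R : realType) (n : nat) (v : 'cV[R]_n) : enorm (- v) = enorm v.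
Proof. by rewrite -scaleN1r enormZ normrN1 mul1r. Qed.

(** Cauchy-Schwarz: the squared norm of [enorm v *: u - enorm u *: v] is nonnegative, and it equals
    [2 * (enorm u * enorm v)] times the wanted difference. *)
Lemma edot_le_enorm (R : realType) (n : nat) (u v : 'cV[R]_n) :
  edot u v <= enorm u * enorm v.
Proof.
have [u0|u0] := eqVneq (enorm u) 0.
  by rewrite u0 (enorm_eq0 u0) edot0l mul0r.
have [v0|v0] := eqVneq (enorm v) 0.
  by rewrite v0 (enorm_eq0 v0) edot0r mulr0.
have uv0 : 0 < enorm u * enorm v.
  by rewrite mulr_gt0// lt_def enorm_ge0 andbT.
have := edot_ge0 (enorm v *: u - enorm u *: v).
rewrite !(edotDl, edotDr, edotNl, edotNr, edotZl, edotZr).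
rewrite (edotC v u) -!sqr_enorm => h.
rewrite -subr_ge0 -(pmulr_rge0 _ uv0).
nra.
Qed.

Lemma ler_enormD (R : realType) (n : nat) (u v : 'cV[R]_n) :
  enorm (u + v) <= enorm u + enorm v.
Proof.
rewrite -(@ler_pXn2r _ 2)// ?nnegrE ?addr_ge0 ?enorm_ge0//.
rewrite sqrrD !sqr_enorm edotDl !edotDr (edotC v u).
have := edot_le_enorm u v; lra.
Qed.

(** Since [opnorm] is a [sup], its set must first be shown to be bounded; the Frobenius norm bounds
    it. Scaling to a unit vector then gives the estimate. *)
Lemma enorm_mulmx_le (R : realType) (m n : nat) (A : 'M[R]_(m, n))
    (v : 'cV[R]_n) :
  enorm (A *m v) <= opnorm A * enorm v.
Proof.
(* [K] is the squared Frobenius norm; Cauchy-Schwarz is applied to each row. *)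
pose K := \sum_i enorm (row i A)^T ^+ 2.
have K0 : 0 <= K by apply: sumr_ge0 => i _; exact: sqr_ge0.
have AK w : enorm (A *m w) ^+ 2 <= K * enorm w ^+ 2.
  rewrite sqr_enorm edotE mulr_suml; apply: ler_sum => i _.
  have -> : (A *m w) i 0 = edot (row i A)^T w.
    by rewrite edotE mxE; apply: eq_bigr => j _; rewrite !mxE.
  rewrite -expr2 -exprMn -(real_normK (num_real _)) lerXn2r// ?nnegrE//.
    by rewrite mulr_ge0// enorm_ge0.
  rewrite ler_norml edot_le_enorm andbT lerNl -edotNl.
  by rewrite (le_trans (edot_le_enorm _ _))// enormN.
set E := [set enorm (A *m v) | v in [set v : 'cV[R]_n | enorm v <= 1]].
have supE : has_sup E.
  split; first by exists (enorm (A *m 0)); exists 0 => //=; rewrite enorm0.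
  exists (Num.sqrt K) => _ [w /= w1 <-].
  rewrite -[leLHS]ger0_norm ?enorm_ge0// -sqrtr_sqr ler_sqrt//.
  rewrite (le_trans (AK w))//.
  by rewrite ler_piMr// exprn_ile1// enorm_ge0.
have [v0|v0] := eqVneq (enorm v) 0.
  by rewrite (enorm_eq0 v0) mulmx0 !enorm0 mulr0.
have v_gt0 : 0 < enorm v by rewrite lt_def v0 enorm_ge0.
rewrite -ler_pdivrMr// mulrC -[X in X * _]ger0_norm ?invr_ge0 ?enorm_ge0//.
rewrite -enormZ scalemxAr; apply: sup_upper_bound => //.
exists ((enorm v)^-1 *: v) => //=.
by rewrite enormZ ger0_norm ?invr_ge0 ?enorm_ge0// mulVf.
Qed.

(** Limits are taken in the sup-norm topology; this carries them over to the Euclidean norm. *)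
Lemma enorm_continuous (R : realType) (n : nat) :
  continuous (@enorm R n).
Proof.
have sq : continuous (fun v : 'cV[R]_n => \sum_(i < n) v i 0 ^+ 2).
  apply: (@continuous_big _ _ +%R 0 predT) => [|i _].
    exact: add_continuous.
  move=> v; apply: (@continuous_comp _ _ _ (fun w : 'cV[R]_n => w i 0)
    (fun y => y ^+ 2)); first exact: coord_continuous.
  exact: exprn_continuous.
move=> v; apply: (@continuous_comp _ _ _ _ Num.sqrt); first exact: sq.
exact: sqrt_continuous.
Qed.

(* First-order optimality of [w]: the perturbation of [w] along the residual
   [F *m w - l *: w] would otherwise decrease the Rayleigh quotient. *)
Lemma unit_ball_minimizer_eigen (R : realType) (n : nat) (F : 'M[R]_n)
    (w : 'cV[R]_n) :
  F^T = F -> unit_ball_minimizer F w -> F *m w = qform F w *: w.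
Proof.
move=> Fsym [w1 wmin]; set l := qform F w.
(* Homogeneity extends minimality from the unit ball to all vectors. *)
have lmin u : l * edot u u <= qform F u.
  have [u0|u0] := eqVneq (enorm u) 0.
    by rewrite (enorm_eq0 u0) qformE mulmx0 edot0l mulr0.
  have u_gt0 : 0 < enorm u by rewrite lt_def u0 enorm_ge0.
  have := wmin ((enorm u)^-1 *: u).
  rewrite enormZ ger0_norm ?invr_ge0 ?enorm_ge0// mulVf// => /(_ (lexx _)).
  rewrite !qformE -scalemxAr edotZl edotZr mulrA -expr2 exprVn.
  by rewrite ler_pdivlMl ?exprn_gt0// mulrC sqr_enorm /l qformE.
(* The existential keeps the residual [p] opaque during the expansions below. *)
have [p pE] : exists p, p = F *m w - l *: w by exists (F *m w - l *: w).
apply/eqP; rewrite -subr_eq0 -pE; apply/eqP/edot_eq0.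
set a := edot p p; set c := qform F p - l * a.
have a0 : 0 <= a by exact: edot_ge0.
have c0 : 0 <= c by rewrite subr_ge0; exact: lmin.
have h s : 0 <= 2 * s * a + s ^+ 2 * c.
  have := lmin (w + s *: p); rewrite -subr_ge0.
  have pw : edot w (F *m p) = edot p (F *m w).
    by rewrite edot_mulmx Fsym edotC.
  have ww : edot w w = 1 by rewrite -sqr_enorm w1 expr1n.
  have pFw : edot p (F *m w) = a + l * edot p w.
    apply/eqP; rewrite -subr_eq; apply/eqP.
    by rewrite -edotZr -edotNr -edotDr -pE.
  have lE : l = edot w (F *m w) by rewrite /l qformE.
  rewrite /c !qformE mulmxDr -scalemxAr.
  rewrite !(edotDl, edotDr, edotZl, edotZr) (edotC w p) pw ww -lE.
  rewrite pFw -/a => h.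
  apply: le_trans h _; rewrite le_eqVlt; apply/orP; left; apply/eqP.
  by ring.
(* The parabola [h] is tested at [s = - b] with [b = a / (c + 1)], where [c + 1] avoids dividing by
   a possibly zero [c]. Its value there is [- b ^+ 2 * (c + 2)], which forces [b = 0]. *)
have c1 : 0 < c + 1 by lra.
have := h (- (a / (c + 1))); set b := a / (c + 1).
have -> : a = b * (c + 1) by rewrite /b divfK// gt_eqF.
move=> hb; suff -> : b = 0 by rewrite mul0r.
apply/eqP; rewrite -sqrf_eq0 eq_le sqr_ge0 andbT; nra.
Qed.

(** * Derivatives along lines and symmetry of second derivatives *)

(** Both derivatives are limits of the same difference quotient, as a function of [h]. *)
Lemma is_derive_line (R : realType) (V : normedModType R) (f : V -> R)
    (a v : V) (s df : R) :
  is_derive (a + s *: v) v f df ->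
  is_derive s 1 (fun p : R => f (a + p *: v)) df.
Proof.
move=> [dfv <-].
have quotE : (fun h : R =>
    h^-1 *: (((fun p : R => f (a + p *: v)) \o shift s) (h *: (1 : R)) -
             f (a + s *: v))) =
  (fun h : R => h^-1 *: ((f \o shift (a + s *: v)) (h *: v) - f (a + s *: v))).
  apply/funext => h /=; congr (_ *: (f _ - _)).
  by rewrite [_%:A]mulr1 scalerDl addrCA addrA.
by split; rewrite /derivable /derive quotE.
Qed.

Lemma MVT_from0 (R : realType) (phi dphi : R -> R) (h : R) :
  0 < h -> (forall s : R, is_derive s 1 phi (dphi s)) ->
  exists2 c, 0 < c < h & phi h - phi 0 = h * dphi c.
Proof.
move=> h0 dphiP.
have [|c] := @MVT R phi dphi 0 h h0 (fun s _ => dphiP s).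
  apply/continuous_subspaceT => s.
  by apply/differentiable_continuous/derivable1_diffP; have [] := dphiP s.
by rewrite in_itv/= subr0 mulrC => ch E; exists c.
Qed.

(** The mean value theorem is used twice: along [u] for the difference of [f] on two parallel
    segments, then along [v] for [fu]. *)
Lemma second_difference (R : realType) (V : normedModType R)
    (f fu fuv : V -> R) (a u v : V) (h : R) :
  (forall x, is_derive x u f (fu x)) -> (forall x, is_derive x v fu (fuv x)) ->
  0 < h ->
  exists p q : R, [/\ 0 < p < h, 0 < q < h &
    f (a + h *: u + h *: v) - f (a + h *: u) - (f (a + h *: v) - f a) =
    h ^+ 2 * fuv (a + p *: u + q *: v)].
Proof.
move=> fuP fuvP h0.
have d1 (s : R) : is_derive s (1 : R)
    (fun p : R => f (a + h *: v + p *: u) - f (a + p *: u))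
    (fu (a + h *: v + s *: u) - fu (a + s *: u)).
  by apply: (@is_deriveB _ _ _ (fun p : R => f (a + h *: v + p *: u))
    (fun p : R => f (a + p *: u))); apply: is_derive_line; exact: fuP.
have [p ph pE] := MVT_from0 h0 d1.
have d2 (s : R) : is_derive s (1 : R)
    (fun q : R => fu (a + p *: u + q *: v)) (fuv (a + p *: u + s *: v)).
  by apply: is_derive_line; exact: fuvP.
have [q qh qE] := MVT_from0 h0 d2.
exists p, q; split => //.
move: pE qE; rewrite !scale0r !addr0 !(addrAC a (h *: v)) => -> qE.
by rewrite qE expr2 mulrA.
Qed.

(* Schwarz's theorem: both mixed derivatives at [a] are limits of the same
   second difference divided by [h ^+ 2]. *)
Lemma mixed_derive_comm (R : realType) (V : normedModType R)
    (f fu fv fuv fvu : V -> R) (a u v : V) :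
  (forall x, is_derive x u f (fu x)) -> (forall x, is_derive x v fu (fuv x)) ->
  (forall x, is_derive x v f (fv x)) -> (forall x, is_derive x u fv (fvu x)) ->
  {for a, continuous fuv} -> {for a, continuous fvu} ->
  fuv a = fvu a.
Proof.
move=> fuP fuvP fvP fvuP cuv cvu; apply/eqP; rewrite -subr_eq0 -normr_eq0.
rewrite eq_le normr_ge0 andbT; apply/ler_addgt0Pr => e e0; rewrite add0r.
(* Continuity is pulled back along the map from [(p, q)] to [a + p *: u' + q *: v'], so that one
   radius controls both parameters. *)
have near_a (g : V -> R) (u' v' : V) : {for a, continuous g} ->
    exists2 d : R, 0 < d & forall p q : R, 0 < p < d -> 0 < q < d ->
      `|g a - g (a + p *: u' + q *: v')| < e / 2.
  move=> cg.
  have cG : (fun z : R * R => g (a + z.1 *: u' + z.2 *: v')) @ ((0, 0) : R * R)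
      --> g a.
    have ca : (fun z : R * R => a + z.1 *: u' + z.2 *: v') @ ((0, 0) : R * R)
        --> a + (0 : R) *: u' + (0 : R) *: v'.
      apply: cvgD; first apply: cvgD; first exact: cvg_cst.
        by apply: cvgZr_tmp; exact: cvg_fst.
      by apply: cvgZr_tmp; exact: cvg_snd.
    by apply: cvg_comp ca _; rewrite !scale0r !addr0.
  move/cvgrPdist_lt : cG => /(_ (e / 2)); rewrite divr_gt0// => /(_ isT).
  move=> /nbhs_ballP[d /= d0 dP]; exists d => // p q /andP[p0 pd] /andP[q0 qd].
  by apply: (dP (p, q)); split => /=;
    rewrite /ball/= sub0r normrN gtr0_norm.
have [d1 d10 h1] := near_a _ u v cuv.
have [d2 d20 h2] := near_a _ v u cvu.
pose h := Num.min d1 d2.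
have h0 : 0 < h by rewrite lt_min d10.
have [p [q [/andP[p0 ph] /andP[q0 qh] E]]] := second_difference a fuP fuvP h0.
have [p' [q' [/andP[p'0 p'h] /andP[q'0 q'h] E']]] :=
  second_difference a fvP fvuP h0.
(* The two second differences differ only in the order of their middle terms; [h ^+ 2] cancels. *)
have EE : fuv (a + p *: u + q *: v) = fvu (a + p' *: v + q' *: u).
  have hh : h ^+ 2 != 0 by rewrite sqrf_eq0 gt_eqF.
  apply: (mulfI hh); rewrite -E -E' [a + h *: v + _]addrAC.
  by rewrite !opprB addrACA [in RHS]addrACA; congr (_ + _); rewrite addrC.
have {h1} := h1 p q; have {h2} := h2 p' q'.
move: ph qh p'h q'h; rewrite !lt_min.
move=> /andP[-> _] /andP[-> _] /andP[_ ->] /andP[_ ->].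
rewrite p0 q0 p'0 q'0 EE => /(_ isT isT) + /(_ isT isT).
(* The common value [C] lies within [e / 2] of both mixed derivatives at [a]. *)
move: (fvu (_ + _)) => C vC uC.
rewrite ltW// [ltRHS]splitr.
by rewrite (le_lt_trans (ler_distD C _ _))// [`|C - _|]distrC ltrD.
Qed.

Lemma derive_col (R : realType) (n : nat) (h : 'cV[R]_n -> R)
    (x v : 'cV[R]_n) :
  differentiable h x ->
  'D_v h x = \sum_i 'D_(delta_mx i 0) h x * v i 0.
Proof.
move=> dh; rewrite deriveE// {1}(matrix_sum_delta v) linear_sum.
apply: eq_bigr => i _; rewrite big_ord1 linearZ/= deriveE//.
by rewrite mulrC.
Qed.

Lemma hessianE (R : realType) (n : nat) (f : 'cV[R]_n -> R) (x : 'cV[R]_n)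
    (i j : 'I_n) :
  hessian f x i j = 'D_(delta_mx j 0) ('D_(delta_mx i 0) f) x.
Proof.
by rewrite mxE; congr ('D__ _ x); apply/funext => y; rewrite mxE.
Qed.

Lemma differentiable_partial (R : realType) (n : nat) (f : 'cV[R]_n -> R)
    (i : 'I_n) (x : 'cV[R]_n) :
  twice_continuously_differentiable f ->
  differentiable ('D_(delta_mx i 0) f) x.
Proof.
move=> [_ dg _].
have -> : 'D_(delta_mx i 0) f =
    (fun A : 'cV[R]_n => A i 0) \o gradient f.
  by apply/funext => y /=; rewrite mxE.
by apply: differentiable_comp => //; exact: differentiable_coord.
Qed.

(** This makes the homogenized matrix symmetric, so that its minimizers are eigenvectors. *)
Lemma hessian_sym (R : realType) (n : nat) (f : 'cV[R]_n -> R)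
    (x : 'cV[R]_n) :
  twice_continuously_differentiable f -> (hessian f x)^T = hessian f x.
Proof.
move=> hf; have [df _ cH] := hf.
have cDD i j :
    {for x, continuous ('D_(delta_mx j 0) ('D_(delta_mx i 0) f))}.
  have -> : 'D_(delta_mx j 0) ('D_(delta_mx i 0) f) =
      (fun A : 'M[R]_n => A i j) \o hessian f.
    by apply/funext => y /=; rewrite hessianE.
  by apply: continuous_comp; [exact: cH|exact: coord_continuous].
apply/matrixP => i j; rewrite mxE !hessianE.
have dP k y : is_derive y (delta_mx k 0) f ('D_(delta_mx k 0) f y).
  exact/derivableP/diff_derivable.
have ddP k l y : is_derive y (delta_mx l 0) ('D_(delta_mx k 0) f)
    ('D_(delta_mx l 0) ('D_(delta_mx k 0) f) y).
  exact/derivableP/diff_derivable/differentiable_partial.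
exact: (@mixed_derive_comm _ _ f _ _
  ('D_(delta_mx i 0) ('D_(delta_mx j 0) f))
  ('D_(delta_mx j 0) ('D_(delta_mx i 0) f)) x _ _
  (dP j) (ddP j i) (dP i) (ddP i j) (cDD j i) (cDD i j)).
Qed.

(** * Taylor estimate for the gradient *)

(** Pairing with a fixed [w] makes the gradient scalar-valued, within reach of the mean value
    theorem. *)
Lemma is_derive_gradient_line (R : realType) (n : nat) (f : 'cV[R]_n -> R)
    (x e w : 'cV[R]_n) (s : R) :
  twice_continuously_differentiable f ->
  is_derive s 1 (fun p : R => edot w (gradient f (x + p *: e)))
    (edot w (hessian f (x + s *: e) *m e)).
Proof.
move=> hf.
have -> : (fun p : R => edot w (gradient f (x + p *: e))) =
    \sum_(i < n) (fun p : R => w i 0 *: 'D_(delta_mx i 0) f (x + p *: e)).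
  apply/funext => p; rewrite edotE fct_sumE.
  by apply: eq_bigr => i _; rewrite mxE.
have -> : edot w (hessian f (x + s *: e) *m e) =
    \sum_(i < n) w i 0 *: 'D_e ('D_(delta_mx i 0) f) (x + s *: e).
  rewrite edotE; apply: eq_bigr => i _; congr (_ * _); rewrite mxE derive_col.
    by apply: eq_bigr => j _; rewrite hessianE.
  exact: differentiable_partial.
apply: is_derive_sum => i; apply: is_deriveZ.
apply: (is_derive_line (f := 'D_(delta_mx i 0) f)).
exact/derivableP/diff_derivable/differentiable_partial.
Qed.

(* [c / 2] is the integral of [c * (1 - s)] over [0, 1]: add the primitive
   [c / 2 * (1 - s) ^+ 2] and use the mean value theorem. *)
Lemma le_increment_half (R : realType) (phi dphi : R -> R) (k c : R) :
  (forall s : R, is_derive s 1 phi (dphi s)) ->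
  (forall s, 0 < s < 1 -> dphi s - k <= c * (1 - s)) ->
  phi 1 - phi 0 - k <= c / 2.
Proof.
move=> dphiP dphi_le.
have dpsi (s : R) : is_derive s (1 : R)
    (phi - k \*: (@id R) + (c / 2) \*: ((cst (1 : R) - @id R) ^+ 2))
    (dphi s - k - c * (1 - s)).
  apply: is_derive_eq; rewrite !fctE /GRing.scale/=; move: (dphi s) => p.
  by field.
have [s s01 E] := MVT_from0 ltr01 dpsi.
(* The same equality with the operations on functions evaluated, by conversion. *)
have {}E : phi 1 - k * 1 + c / 2 * (1 - 1) ^+ 2 -
    (phi 0 - k * 0 + c / 2 * (1 - 0) ^+ 2) =
  1 * (dphi s - k - c * (1 - s)) := E.
by have := dphi_le s s01; lra.
Qed.

(** The remainder [w] is paired with itself: along the segment, the derivative of this pairing is at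
    most [M * enorm w * enorm e ^+ 2 * (1 - s)]. Integration gives the factor 1/2, and one [enorm w]
    cancels. The Hessian is taken at the endpoint [y] because the step uses the Hessian of the
    current iterate. *)
Lemma gradient_taylor (R : realType) (n : nat) (f : 'cV[R]_n -> R)
    (M : R) (X : set 'cV[R]_n) (x y : 'cV[R]_n) :
  twice_continuously_differentiable f -> 0 <= M ->
  convex_set X -> hessian_lipschitz_on M X f -> X x -> X y ->
  enorm (gradient f y - gradient f x - hessian f y *m (y - x)) <=
    M / 2 * enorm (y - x) ^+ 2.
Proof.
move=> hf M0 Xc Lip Xx Xy; set e := y - x.
set w := gradient f y - gradient f x - hessian f y *m e.
have ye : y = x + 1 *: e by rewrite scale1r /e addrC subrK.
have w2 : enorm w ^+ 2 <= M * enorm w * enorm e ^+ 2 / 2.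
  have -> : enorm w ^+ 2 = edot w (gradient f (x + 1 *: e)) -
      edot w (gradient f (x + 0 *: e)) - edot w (hessian f y *m e).
    by rewrite -!edotNr -!edotDr sqr_enorm -ye scale0r addr0.
  apply: (le_increment_half (fun s => is_derive_gradient_line x e w s hf)).
  move=> s /andP[s0 s1].
  have Xs : X (x + s *: e).
    have := @Xc y x (Itv01 (ltW s0) (ltW s1)); rewrite !inE => /(_ Xy Xx).
    suff -> : x + s *: e = s *: y + (1 - s) *: x by [].
    by rewrite /e scalerBr scalerBl scale1r addrCA.
  rewrite -edotNr -edotDr -mulmxBl (le_trans (edot_le_enorm _ _))//.
  have -> : M * enorm w * enorm e ^+ 2 * (1 - s) =
      enorm w * (M * ((1 - s) * enorm e) * enorm e).
    by move: (enorm w) (enorm e) => a b; ring.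
  apply: ler_wpM2l; first exact: enorm_ge0.
  apply: le_trans (enorm_mulmx_le _ _) _.
  apply: ler_wpM2r; first exact: enorm_ge0.
  apply: le_trans (Lip _ _ Xs Xy) _.
  have -> : x + s *: e - y = (s - 1) *: e.
    by rewrite scalerBl scale1r /e opprB addrAC addrC.
  by rewrite enormZ distrC gtr0_norm ?subr_gt0.
move: w2; have := enorm_ge0 w; have := enorm_ge0 e.
move: (enorm w) (enorm e) => a b b0 a0 w2.
have [->|a_neq0] := eqVneq a 0; first by rewrite mulr_ge0 ?sqr_ge0// divr_ge0.
have a_gt0 : 0 < a by rewrite lt_def a_neq0.
by rewrite -(ler_pM2l a_gt0) -expr2 (le_trans w2)// mulrA; lra.
Qed.

(* The limit [y], like that of the iterates, is only in the closure of [X]. *)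
Lemma gradient_taylor_limit (R : realType) (n : nat) (f : 'cV[R]_n -> R)
    (M : R) (X : set 'cV[R]_n) (x : nat -> 'cV[R]_n) (y z : 'cV[R]_n) :
  twice_continuously_differentiable f -> 0 <= M ->
  convex_set X -> hessian_lipschitz_on M X f ->
  (forall k, X (x k)) -> x @ \oo --> y -> X z ->
  enorm (gradient f z - gradient f y - hessian f z *m (z - y)) <=
    M / 2 * enorm (z - y) ^+ 2.
Proof.
move=> hf M0 Xc Lip Xx xy Xz; have [_ dg _] := hf.
set U := opnorm (hessian f z).
have enorm_cvg (u : nat -> 'cV[R]_n) (l : 'cV[R]_n) :
    u @ \oo --> l -> enorm (u k) @[k --> \oo] --> enorm l.
  by move=> ul; apply: continuous_cvg ul; exact: enorm_continuous.
have gy : gradient f (x k) @[k --> \oo] --> gradient f y.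
  by apply: continuous_cvg xy; exact/differentiable_continuous/dg.
have c1 : enorm (z - x k) @[k --> \oo] --> enorm (z - y).
  by apply: enorm_cvg; apply: cvgB => //; exact: cvg_cst.
have c2 : enorm (gradient f (x k) - gradient f y) @[k --> \oo] --> (0 : R).
  rewrite -(enorm0 R n) -(subrr (gradient f y)).
  by apply: enorm_cvg; apply: cvgB => //; exact: cvg_cst.
have c3 : enorm (x k - y) @[k --> \oo] --> (0 : R).
  rewrite -(enorm0 R n) -(subrr y).
  by apply: enorm_cvg; apply: cvgB => //; exact: cvg_cst.
(* The right-hand side collects the Taylor bound between [z] and [x k] and the two errors made by
   replacing [y] with [x k]. *)
have cs : M / 2 * (enorm (z - x k) * enorm (z - x k)) +
    enorm (gradient f (x k) - gradient f y) + U * enorm (x k - y) @[k --> \oo]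
    --> M / 2 * (enorm (z - y) * enorm (z - y)) + 0 + U * 0.
  apply: cvgD; first apply: cvgD => //.
    by apply: cvgM; [exact: cvg_cst|apply: cvgM].
  by apply: cvgM => //; exact: cvg_cst.
rewrite mulr0 !addr0 -expr2 in cs.
apply: (ler_cvg_to (cvg_cst _) cs); apply: nearW => k.
have -> : gradient f z - gradient f y - hessian f z *m (z - y) =
    (gradient f z - gradient f (x k) - hessian f z *m (z - x k)) +
    (gradient f (x k) - gradient f y) + - (hessian f z *m (x k - y)).
  rewrite !mulmxBr !opprB.
  by apply/colP => i; rewrite !mxE; ring.
rewrite (le_trans (ler_enormD _ _))// lerD//; last first.
  by rewrite enormN enorm_mulmx_le.
rewrite (le_trans (ler_enormD _ _))// lerD// -expr2.
exact: gradient_taylor Lip _ _.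
Qed.

(** * Minimizers of the homogenized form and the regularized Newton step *)

Lemma enorm_le_coercive (R : realType) (n : nat) (mu : R) (u z : 'cV[R]_n) :
  mu * edot u u <= edot u z -> mu * enorm u <= enorm z.
Proof.
move=> /le_trans /(_ (edot_le_enorm _ _)); rewrite -sqr_enorm.
have := enorm_ge0 z; have := enorm_ge0 u.
have [->|u0] := eqVneq (enorm u) 0; first by rewrite mulr0.
move=> u_ge0 _ h; have u_gt0 : 0 < enorm u by rewrite lt_def u0.
by rewrite -(ler_pM2l u_gt0) mulrCA -expr2.
Qed.

Lemma edot_col_mx (R : realType) (m n : nat) (u u' : 'cV[R]_m)
    (v v' : 'cV[R]_n) :
  edot (col_mx u v) (col_mx u' v') = edot u u' + edot v v'.
Proof. by rewrite /edot tr_col_mx mul_row_col mxE. Qed.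

Lemma homogenized_mulmx (R : realType) (n : nat) (H : 'M[R]_n)
    (g v : 'cV[R]_n) (t : R) :
  homogenized_mx H g 0 *m col_mx v t%:M =
  col_mx (H *m v + t *: g) (edot g v)%:M.
Proof.
rewrite mul_block_col mul_mx_scalar oppr0 raddf0 mul0mx addr0; congr col_mx.
by rewrite [LHS]mx11_scalar.
Qed.

(* The minimal eigenvalue of the homogenized matrix is [- theta]; it is
   nonpositive because the corner entry of the matrix is 0. *)
Lemma homogenized_minimizer (R : realType) (n : nat) (H : 'M[R]_n)
    (g v : 'cV[R]_n) (t mu : R) :
  H^T = H -> 0 < mu -> (forall u, mu * edot u u <= edot u (H *m u)) ->
  unit_ball_minimizer (homogenized_mx H g 0) (col_mx v t%:M) ->
  [/\ t ^+ 2 * (1 + enorm (t^-1 *: v) ^+ 2) = 1,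
      edot g (t^-1 *: v) <= 0 &
      H *m (t^-1 *: v) - edot g (t^-1 *: v) *: (t^-1 *: v) = - g].
Proof.
move=> Hsym mu0 Hmu vtmin.
have Fsym : (homogenized_mx H g 0)^T = homogenized_mx H g 0.
  by rewrite tr_block_mx Hsym trmxK tr_scalar_mx.
have := unit_ball_minimizer_eigen Fsym vtmin; set l := qform _ _.
have [vt1 lmin] := vtmin.
have e11 (a b : R) : edot (a%:M : 'cV[R]_1) b%:M = a * b.
  by rewrite edotE big_ord1 !mxE eqxx !mulr1n.
have l0 : l <= 0.
  (* The last basis vector is a competitor of value 0. *)
  have -> : 0 = qform (homogenized_mx H g 0) (col_mx 0 1%:M).
    rewrite qformE homogenized_mulmx edot_col_mx e11 edot0l edot0r.
    by rewrite mulr0 addr0.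
  apply: lmin; rewrite enormE edot_col_mx e11 edot0l add0r.
  by rewrite mulr1 sqrtr1.
rewrite homogenized_mulmx scale_col_mx scale_scalar_mx => /eq_col_mx[vE].
move=> /(congr1 (fun A : 'M[R]_1 => A 0 0)); rewrite !mxE eqxx !mulr1n => tE.
have vt : edot v v + t ^+ 2 = 1.
  by rewrite expr2 -e11 -edot_col_mx -sqr_enorm vt1 expr1n.
(* With [t = 0], the unit vector [v] would be an eigenvector of [H] for [l <= 0], against the lower
   bound [mu]. *)
have t0 : t != 0.
  apply/eqP => t0; move: vE vt; rewrite t0 scale0r addr0 expr0n addr0 => vE v1.
  have := Hmu v; rewrite vE edotZr v1; lra.
have dl : edot g (t^-1 *: v) = l by rewrite edotZr tE mulrCA mulVf// mulr1.
split.
- rewrite enormZ exprMn real_normK ?num_real// sqr_enorm mulrDr mulr1.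
  by rewrite mulrA -exprMn mulfV// expr1n mul1r addrC.
- by rewrite dl.
- have Hv : H *m v = l *: v - t *: g by rewrite -vE addrK.
  rewrite dl -scalemxAr Hv scalerBr !scalerA mulVf// scale1r [l * _]mulrC.
  by rewrite addrAC subrr add0r.
Qed.

(* The regularized Newton equation [(H + theta) d = - g], [theta = - edot g d],
   gives [(H + theta) (e + d) = (H e - g) + theta e], where [theta] is at most
   [enorm g ^+ 2 / mu]. *)
Lemma regularized_newton_step (R : realType) (n : nat) (H : 'M[R]_n)
    (g d e : 'cV[R]_n) (mu C M : R) :
  0 < mu -> (forall u, mu * edot u u <= edot u (H *m u)) ->
  edot g d <= 0 -> H *m d - edot g d *: d = - g ->
  enorm (g - H *m e) <= M / 2 * enorm e ^+ 2 ->
  enorm g <= C * enorm e -> C ^+ 2 * enorm e <= mu * (M / 2) ->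
  mu * enorm d <= enorm g /\ enorm (e + d) <= M / mu * enorm e ^+ 2.
Proof.
move=> mu0 Hmu; set th := edot g d => th0 dE he hg hC.
(* As [th <= 0], subtracting [th] from [H] preserves the lower bound [mu]. *)
have coer u : mu * enorm u <= enorm (H *m u - th *: u).
  apply: enorm_le_coercive; rewrite edotDr edotNr edotZr.
  have := Hmu u; have := mulr_le0_ge0 th0 (edot_ge0 u); lra.
have dg : mu * enorm d <= enorm g by rewrite -(enormN g) -dE.
split => //.
have thE : - th * mu <= enorm g ^+ 2.
  have : - th <= enorm g * enorm d.
    by rewrite /th -edotNl (le_trans (edot_le_enorm _ _))// enormN.
  have := enorm_ge0 g; move: dg; move: (enorm g) (enorm d) => a b; nra.
(* The Taylor remainder and [- th * enorm e] each contribute at most [M / 2 * enorm e ^+ 2], whence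
   the constant [M / mu]. *)
have : mu * enorm (e + d) <= M / 2 * enorm e ^+ 2 + - th * enorm e.
  rewrite (le_trans (coer _))//.
  have -> : H *m (e + d) - th *: (e + d) = - (g - H *m e) + (- th) *: e.
    have <- : - (H *m d - th *: d) = g by rewrite dE opprK.
    by rewrite mulmxDr; apply/colP => i; rewrite !mxE; ring.
  rewrite (le_trans (ler_enormD _ _))// enormN enormZ ger0_norm ?oppr_ge0//.
  exact: lerD.
have the : - th * enorm e <= M / 2 * enorm e ^+ 2.
  rewrite -(ler_pM2l mu0).
  have e0 := enorm_ge0 e; have g0 := enorm_ge0 g.
  have : enorm g ^+ 2 <= C ^+ 2 * enorm e ^+ 2.
    by rewrite -exprMn lerXn2r// ?nnegrE// (le_trans g0).
  move: thE hC e0; move: (enorm g ^+ 2) (enorm e) => a b; nra.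
move=> h; rewrite -(ler_pM2l mu0) (le_trans h)//.
have -> : mu * (M / mu * enorm e ^+ 2) = M * enorm e ^+ 2.
  by rewrite !mulrA [mu * M]mulrC mulfK// gt_eqF.
lra.
Qed.

(** Here [q] stands for the norm of [v / t]: normalization gives [t ^+ 2 = 1 / (1 + q ^+ 2)], which
    decreases in [q] and meets the threshold at [q = Delta]. *)
Lemma hsodm_small_value_of_small (R : realType) (Delta t q : R) :
  t ^+ 2 * (1 + q ^+ 2) = 1 -> 0 <= q -> q < Delta ->
  hsodm_small_value Delta t.
Proof.
move=> tq q0 qD.
have qD2 : q ^+ 2 < Delta ^+ 2.
  by rewrite ltrXn2r// nnegrE (le_trans q0 (ltW qD)).
have t2 : 0 < t ^+ 2.
  rewrite lt_def sqr_ge0 andbT; apply/eqP => t0.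
  by move: tq; rewrite t0 mul0r => /eqP; rewrite eq_sym oner_eq0.
have D1 : 0 < 1 + Delta ^+ 2 by have := sqr_ge0 Delta; lra.
rewrite /hsodm_small_value -sqrtr_sqr ltr_sqrt// ltr_pdivrMr//; nra.
Qed.

Lemma possemidefmx_shift (R : realType) (n : nat) (H : 'M[R]_n) (mu : R) :
  possemidefmx (H - mu%:M) ->
  forall u, mu * edot u u <= edot u (H *m u).
Proof.
move=> hH u; have := hH u.
by rewrite qformE mulmxBl mul_scalar_mx edotDr edotNr edotZr subr_ge0.
Qed.

Theorem theorem4p1 (R : realType) (n : nat) (f : 'cV[R]_n -> R)
  (nu Delta beta gamma delta0 : R)
  (x : nat -> 'cV[R]_n) (delta : nat -> R)
  (X : set 'cV[R]_n) (M U_H : R) (xstar : 'cV[R]_n) (r mu : R)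
  (hf : twice_continuously_differentiable f)
  (hnu : 0 < nu < 1 / 2)
  (hDelta : 0 < Delta <= Num.sqrt 2 / 2)
  (hbeta : 0 < beta < 1)
  (hgamma : 0 < gamma)
  (hdelta0 : 0 <= delta0)
  (hrun : hsodm_run f nu Delta beta gamma delta0 x delta)
  (hlocal : \forall k \near \oo, delta k = 0)
  (hXopen : open X)
  (hXconvex : convex_set X)
  (hXx : forall k : nat, X (x k))
  (hM : 0 < M)
  (hLip : hessian_lipschitz_on M X f)
  (hU_H : 0 < U_H)
  (hbound : forall k : nat, opnorm (hessian f (x k)) <= U_H)
  (hcvg : x @ \oo --> xstar)
  (hmin : strict_local_minimizer f xstar)
  (hgrad : gradient f xstar = 0)
  (hposdef : posdefmx (hessian f xstar))
  (hr : 0 < r)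
  (hmu : 0 < mu)
  (hstrong : forall y, closed_eball xstar r y ->
     possemidefmx (hessian f y - mu%:M)) :
  \forall k \near \oo,
    enorm (x k.+1 - xstar) <=
      (M / mu + Delta * (M * r + mu) ^+ 2 / (mu ^+ 2 * (1 - Delta ^+ 2) ^+ 2))
      * enorm (x k - xstar) ^+ 2.
Proof.
have [/andP[Delta0 _] M0] := (hDelta, ltW hM).
(* [C] bounds [enorm g / enorm e] once [enorm e <= 1]: [U_H] comes from [H *m e], [M / 2] from the
   Taylor remainder. *)
pose C := U_H + M / 2.
have C0 : 0 < C by rewrite addr_gt0// divr_gt0.
have e_cvg : enorm (x k - xstar) @[k --> \oo] --> (0 : R).
  rewrite -(enorm0 R n) -(subrr xstar); apply: continuous_cvg.
    exact: enorm_continuous.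
  by apply: cvgB => //; exact: cvg_cst.
have e_lt (a : R) : 0 < a -> \forall k \near \oo, enorm (x k - xstar) < a.
  by move=> a0; exact: (cvgr_lt _ e_cvg).
have mu2 : 0 < mu * (M / 2) by rewrite mulr_gt0// divr_gt0.
near=> k.
have dk0 : delta k = 0 by near: k.
have e1 : enorm (x k - xstar) <= 1 by apply/ltW; near: k; exact: e_lt.
have er : enorm (x k - xstar) <= r by apply/ltW; near: k; exact: e_lt.
(* This will force [enorm d < Delta], hence the small value case and the unit step. *)
have eD : C * enorm (x k - xstar) < mu * Delta.
  rewrite -ltr_pdivlMl//; near: k; apply: e_lt.
  by rewrite mulr_gt0 ?invr_gt0 ?mulr_gt0.
have eC : C ^+ 2 * enorm (x k - xstar) <= mu * (M / 2).
  rewrite -ler_pdivlMl ?exprn_gt0//; apply/ltW; near: k; apply: e_lt.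
  by rewrite mulr_gt0 ?invr_gt0 ?exprn_gt0.
have Hmu := possemidefmx_shift (hstrong _ er).
move: e1 er eD eC Hmu; set e := x k - xstar => e1 er eD eC.
set g := gradient f (x k); set H := hessian f (x k) => Hmu.
have e0 := enorm_ge0 e.
have ge : enorm (g - H *m e) <= M / 2 * enorm e ^+ 2.
  have := gradient_taylor_limit hf M0 hXconvex hLip hXx hcvg (hXx k).
  by rewrite hgrad subr0.
have gC : enorm g <= C * enorm e.
  rewrite -[g](subrK (H *m e)) (le_trans (ler_enormD _ _))//.
  have He : enorm (H *m e) <= U_H * enorm e.
    exact: le_trans (enorm_mulmx_le _ _) (ler_wpM2r e0 (hbound k)).
  have : M / 2 * enorm e ^+ 2 <= M / 2 * enorm e.
    by rewrite ler_wpM2l ?divr_ge0// expr2 ler_piMl.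
  by rewrite /C mulrDl; lra.
have [_ /(_ k)] := hrun; rewrite /hsodm_step dk0 => -[v [t [vtmin]]].
have [tE gd dE] := homogenized_minimizer (hessian_sym (x k) hf) hmu Hmu vtmin.
have [dg ed] := regularized_newton_step hmu Hmu gd dE ge gC eC.
have small : hsodm_small_value Delta t.
  apply: (hsodm_small_value_of_small tE); first exact: enorm_ge0.
  by rewrite -(ltr_pM2l hmu) (le_lt_trans dg)// (le_lt_trans gC).
rewrite /hsodm_direction small /= => -[-> _].
have -> : x k + t^-1 *: v - xstar = e + t^-1 *: v by rewrite addrAC.
(* The second summand of the rate is nonnegative, so the bound by [M / mu] is enough. *)
rewrite (le_trans ed)// ler_wpM2r ?sqr_ge0// lerDl.
by rewrite divr_ge0// mulr_ge0 ?sqr_ge0// ltW.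
Unshelve. all: by end_near. Qed.
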